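(* For every $k\ge2$, $n\ge0$ and all integers $m_1,\dots,m_k$ (of any sign), $$\mathcal D_k(m_1,\dots,m_k;n)=\sum_{t_1,\dots,t_{k-1}\ge0}N\Big(\sum_{i=1}^k|m_i|+2\sum_{i=1}^{k-1}t_i+k-1;\,n\Big).$$
   Context: A partition is a finite nonincreasing sequence $\lambda=(\lambda_1,\dots,\lambda_r)$ of positive integers (possibly empty); $l(\lambda)=r$, $|\lambda|=\sum\lambda_i$, $\lambda_1$ the largest part. For integers $m$ and $n\ge0$, $N(m;n)$ is the number of partitions $\lambda$ of $n$ with $\lambda_1-l(\lambda)=m$ (the empty partition of $0$ having rank $0$). Let $k\ge1$. A $k$-marked Durfee symbol of $n$ is an array $\eta=\begin{pmatrix}\alpha^k,&\dots,&\alpha^1\\ \beta^k,&\dots,&\beta^1\end{pmatrix}_D$ consisting of an integer $D\ge0$ and $2k$ partitions $\alpha^i,\beta^i$ with $\sum_{i=1}^k(|\alpha^i|+|\beta^i|)+D^2=n$, such that: (1) $\alpha^i$ is nonempty for $1\le i<k$; (2) for $1\le i<k$ every part of $\beta^i$ is $\le\alpha^i_1$, and for $2\le i\le k$ every part of $\alpha^i$ and every part of $\beta^i$ is $\ge\alpha^{i-1}_1$; (3) all parts of $\alpha^k$ and $\beta^k$ are $\le D$. The $i$th rank is $\rho_i(\eta)=l(\alpha^i)-l(\beta^i)-1$ for $1\le i<k$ and $\rho_k(\eta)=l(\alpha^k)-l(\beta^k)$. $\mathcal D_k(m_1,\dots,m_k;n)$ is the number of $k$-marked Durfee symbols of $n$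 with $\rho_i=m_i$ for all $i$.
   Formalization: Condition (3) is corrected: all parts of every α^i and β^i, not only of α^k and β^k, must be ≤ D; as written the identity fails for k=2, n=1, m=(0,0), with D=0, α^1=(1) and the other partitions empty. *)

(* Defs.v *)
From HB Require Import structures.
From mathcomp Require Import all_boot all_order all_algebra.
Set Implicit Arguments. Unset Strict Implicit. Unset Printing Implicit Defensive.

Definition is_partition (s : seq nat) : bool :=
  sorted geq s && all (fun x => 0 < x) s.

Definition lpart (s : seq nat) : nat := head 0 s.

Definition prank (s : seq nat) : int := ((lpart s)%:Z - (size s)%:Z)%R.

Fixpoint seqs_upto (b L : nat) : seq (seq nat) :=
  match L with
  | 0 => [:: [::]]
  | L'.+1 => [::] :: [seq x :: s | x <- iota 0 b.+1, s <- seqs_upto b L']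
  end.

(* All partitions lambda with |lambda| <= n (these have length <= n and parts <= n). *)
Definition partitions_upto (n : nat) : seq (seq nat) :=
  [seq s <- seqs_upto n n | is_partition s & sumn s <= n].

Definition partitions (n : nat) : seq (seq nat) :=
  [seq s <- partitions_upto n | sumn s == n].

Definition Nrank (m : int) (n : nat) : nat :=
  count (fun s => prank s == m) (partitions n).

Fixpoint lists_of (T : Type) (k : nat) (xs : seq T) : seq (seq T) :=
  match k with
  | 0 => [:: [::]]
  | k'.+1 => [seq x :: l | x <- xs, l <- lists_of k' xs]
  end.

(* A candidate k-marked Durfee symbol: (D, [:: (alpha^1,beta^1); ...; (alpha^k,beta^k)])
   (0-based list index j corresponds to the paper's index i = j+1). *)
Definition dsym := (nat * seq (seq nat * seq nat))%type.

Definition dalpha (e : dsym) (j : nat) : seq nat := nth [::] (map fst e.2) j.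
Definition dbeta  (e : dsym) (j : nat) : seq nat := nth [::] (map snd e.2) j.

Definition is_durfee (k n : nat) (e : dsym) : bool :=
  let D := e.1 in
  [&& size e.2 == k,
      all (fun p => is_partition p.1 && is_partition p.2) e.2,
      sumn [seq sumn p.1 + sumn p.2 | p <- e.2] + D * D == n,
      all (fun j => (dalpha e j != [::]) &&
                    all (fun x => x <= lpart (dalpha e j)) (dbeta e j)) (iota 0 k.-1),
      all (fun j => all (fun x => lpart (dalpha e j.-1) <= x) (dalpha e j ++ dbeta e j))
          (iota 1 k.-1) &
      (* (3) parts of alpha^k, beta^k <= D; following Andrews' definition of
         k-marked Durfee symbols, we require all parts of all alpha^i, beta^i
         to be <= D *)
      all (fun p => all (fun x => x <= D) (p.1 ++ p.2)) e.2].

Definition drank (k : nat) (e : dsym) (j : nat) : int :=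
  if j < k.-1 then ((size (dalpha e j))%:Z - (size (dbeta e j))%:Z - 1)%R
  else ((size (dalpha e j))%:Z - (size (dbeta e j))%:Z)%R.

(* Finite list containing every k-marked Durfee symbol of n exactly once
   (D <= n since D^2 <= n; every alpha^i, beta^i has size <= n). *)
Definition durfee_cands (k n : nat) : seq dsym :=
  [seq (D, ps) | D <- iota 0 n.+1,
                 ps <- lists_of k [seq (a, b) | a <- partitions_upto n, b <- partitions_upto n]].

Definition Dk (k : nat) (m : seq int) (n : nat) : nat :=
  count (fun e => is_durfee k n e && all (fun j => drank k e j == nth 0%R m j) (iota 0 k))
        (durfee_cands k n).

(* Main.v *)
Require Import Defs.
From HB Require Import structures.
From mathcomp Require Import all_boot all_order all_algebra.
From mathcomp Require Import zify.

Set Implicit Arguments.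
Unset Strict Implicit.
Unset Printing Implicit Defensive.

(** Write A_i for the largest part of alpha^i (i < k). Removing it from alpha^i leaves a pair of partitions with parts in [A_(i-1), A_i] whose lengths differ by rho_i, so everything is governed by the generating functions G_[a,e)(m) of pairs of partitions with parts in [a, e) and length difference m, and by the one-marker identity
      sum_A q^A G_[a,A](m1) G_[A,e)(m2) = sum_t G_[a,e)(|m1| + |m2| + 2t + 1).
    Iterating it from the last marker to the first merges all the blocks into a single one. Since (1 - z q^e)(1 - q^e / z) sum_m z^m G_[a,e](m) = sum_m z^m G_[a,e)(m), both sides of the identity satisfy the same recurrence
      (1 + q^(2e)) X_(e+1)(m2) - q^e (X_(e+1)(m2 - 1) + X_(e+1)(m2 + 1)) = X_e(m2) + [m2 = 0] q^e G_[a,e](m1),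
    where on the right-hand side the term at m2 = 0 arises from the kink of |m2| by telescoping; this recurrence determines X by induction on e and on the power of q. Finally the Durfee square, followed by conjugation of the part to its right, gives N(m; n) as the sum over D of the coefficients of q^(n - D^2) in G_[1,D](m). *)

(** * Counting by bijection and the enumeration of partitions *)

Lemma count_bij (T U : eqType) (s : seq T) (t : seq U) (p : pred T) (q : pred U)
    (f : T -> U) (g : U -> T) :
  uniq s -> uniq t ->
  (forall x, x \in s -> p x -> [/\ f x \in t, q (f x) & g (f x) = x]) ->
  (forall y, y \in t -> q y -> [/\ g y \in s, p (g y) & f (g y) = y]) ->
  count p s = count q t.
Proof.
move=> us ut hf hg; rewrite -!size_filter -(size_map f).
apply: perm_size; apply: uniq_perm; last 1 first.
- move=> y; rewrite mem_filter; apply/mapP/andP => [[x]|[qy yt]].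
    by rewrite mem_filter => /andP[px xs] ->; have [] := hf x xs px.
  by have [gs pg fg] := hg y yt qy; exists (g y); rewrite // mem_filter pg.
- rewrite map_inj_in_uniq ?filter_uniq // => x y.
  rewrite !mem_filter => /andP[px xs] /andP[py ys] e.
  by have [_ _ <-] := hf x xs px; rewrite e; have [] := hf y ys py.
- exact: filter_uniq.
Qed.

Lemma seqs_uptoS b L :
  seqs_upto b L.+1 = [::] :: [seq x :: s | x <- iota 0 b.+1, s <- seqs_upto b L].
Proof. by []. Qed.

Lemma mem_seqs_upto b L s :
  (s \in seqs_upto b L) = (size s <= L) && all (fun x => x <= b) s.
Proof.
elim: L s => [|L IH] [|x s] //; rewrite seqs_uptoS in_cons [_ == _]/= orFb.
apply/allpairsP/idP => [[[y l] [yb]]|/and3P[sL xb sb]].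
  by move: yb; rewrite IH mem_iota /= => yb /andP[lL lb] [-> ->]; apply/and3P.
by exists (x, s); split; rewrite // ?IH ?mem_iota //; apply/andP.
Qed.

Lemma seqs_upto_uniq b L : uniq (seqs_upto b L).
Proof.
elim: L => // L IH; rewrite seqs_uptoS cons_uniq; apply/andP; split.
  by apply/allpairsP => -[[x s] []].
by apply: allpairs_uniq => //; [exact: iota_uniq|move=> [x s] [y t] _ _ [-> ->]].
Qed.

Lemma partition_size s : is_partition s -> size s <= sumn s.
Proof. by case/andP=> _; elim: s => //= x s IH /andP[x0 /IH]; lia. Qed.

Lemma sumn_bound (s : seq nat) : all (fun x => x <= sumn s) s.
Proof.
by apply/allP; elim: s => //= y s IH x; rewrite inE => /predU1P[->|/IH]; lia.
Qed.

Lemma mem_partitions_upto n s :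
  (s \in partitions_upto n) = is_partition s && (sumn s <= n).
Proof.
rewrite mem_filter mem_seqs_upto; case: (boolP (is_partition s && _)) => // /andP[ps sn].
rewrite (leq_trans (partition_size ps) sn) /=.
by apply: sub_all (sumn_bound s) => x /leq_trans->.
Qed.

Lemma partitions_upto_uniq n : uniq (partitions_upto n).
Proof. exact/filter_uniq/seqs_upto_uniq. Qed.

Lemma is_partition_cons x s :
  is_partition (x :: s) = [&& 0 < x, all (fun y => y <= x) s & is_partition s].
Proof.
rewrite /is_partition /= path_sortedE; last by move=> a b c; rewrite /geq /=; lia.
have -> : all (geq x) s = all (fun y => y <= x) s by [].
by case: (0 < x) (all _ s) (sorted _ s) => [] [] [].
Qed.

(** * Pairs of partitions with parts in an interval *)

Definition pairs_upto N :=
  [seq (a, b) | a <- partitions_upto N, b <- partitions_upto N].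

Lemma mem_pairs_upto N p :
  (p \in pairs_upto N) = (p.1 \in partitions_upto N) && (p.2 \in partitions_upto N).
Proof.
case: p => a b; apply/allpairsP/andP => [[[c d] [h1 h2 [-> ->]]]|[]] //.
by exists (a, b).
Qed.

Lemma pairs_upto_uniq N : uniq (pairs_upto N).
Proof.
by apply: allpairs_uniq; rewrite ?partitions_upto_uniq // => -[a b] [c d] _ _ [-> ->].
Qed.

Definition weight (p : seq nat * seq nat) := sumn p.1 + sumn p.2.

Definition pair_rank (p : seq nat * seq nat) : int := ((size p.1)%:Z - (size p.2)%:Z)%R.

(** The interval is half-open, so that induction on [e] starts at the empty interval [e = a]. *)
Definition parts_in a e := all (fun x => a <= x < e).

(* This is the coefficient of q^N in q^s G(m): multiplying by powers of q instead of lowering the target N avoids truncated subtraction, so the recurrences below need no side condition on N. *)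
Definition pair_count2 N a e1 e2 (m : int) s :=
  count (fun p => [&& parts_in a e1 p.1, parts_in a e2 p.2, pair_rank p == m & s + weight p == N])
        (pairs_upto N).

Notation pair_count N a e := (pair_count2 N a e e).

Lemma pair_count2_sym N a e1 e2 m s :
  pair_count2 N a e1 e2 m s = pair_count2 N a e2 e1 (- m) s.
Proof.
pose swap (p : seq nat * seq nat) := (p.2, p.1); apply: (count_bij (f := swap) (g := swap));
  rewrite ?pairs_upto_uniq // => -[x y]; rewrite !mem_pairs_upto /weight /pair_rank /=.
all: move=> /andP[-> ->] /and4P[-> -> /eqP xy /eqP h]; split=> //=.
all: by apply/andP; split; apply/eqP; lia.
Qed.

Lemma parts_inS a e s : parts_in a e s -> parts_in a e.+1 s.
Proof. by apply: sub_all => x; lia. Qed.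

Lemma parts_in_rec a e x s : is_partition (x :: s) -> a <= e ->
  parts_in a e.+1 (x :: s) = ((x == e) && parts_in a e.+1 s) || parts_in a e (x :: s).
Proof.
rewrite is_partition_cons => /and3P[x0 sx ps] ae /=.
have [->|xe] := eqVneq x e; first by rewrite ae !ltnn leqnn /= orbF.
case ax: (a <= x); rewrite //=.
have -> : (x < e.+1) = (x < e) by lia.
case xe': (x < e) => //=; rewrite /parts_in; apply: eq_in_all => y ys.
by have := allP sx y ys; lia.
Qed.

(** Split on whether the first partition has largest part [e1]; if so, deleting one copy lowers the
    rank by 1 and moves [e1] into the shift. This is the factor 1 - z q^e1. *)
Lemma pair_count2_rec N a e1 e2 m s : 0 < a -> a <= e1 ->
  pair_count2 N a e1.+1 e2 m s =
  pair_count2 N a e1 e2 m s + pair_count2 N a e1.+1 e2 (m - 1) (s + e1).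
Proof.
move=> a0 ae.
rewrite {1}/pair_count2 -size_filter -(count_predC (fun p => head 0 p.1 == e1)) !count_filter addnC.
rewrite /pair_count2; congr (_ + _).
  rewrite /pair_count2; apply: eq_in_count => -[x y]; rewrite mem_pairs_upto /=.
  rewrite mem_partitions_upto => /andP[/andP[px _] _].
  case: x px => [|x0 x] px; first by have -> : (0 != e1) by lia.
  rewrite parts_in_rec //= /parts_in /=; have [->|] := eqVneq x0 e1; first by rewrite ltnn andbF.
  by [].
pose del (p : seq nat * seq nat) := (behead p.1, p.2).
pose ins (p : seq nat * seq nat) := (e1 :: p.1, p.2).
apply: (count_bij (f := del) (g := ins));
  rewrite ?pairs_upto_uniq // => -[x y]; rewrite !mem_pairs_upto /weight /pair_rank /=.
  rewrite !mem_partitions_upto.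
  case: x => [|x0 x]; first by move=> _ /andP[/eqP /= ? _]; lia.
  rewrite is_partition_cons => /andP[/andP[/and3P[_ _ px] ?] ->].
  case/andP=> /eqP /= xe /and4P[/andP[_ hx] -> /eqP ? /eqP ?].
  rewrite px hx /ins /= xe; split=> //; first by rewrite andbT; lia.
  by apply/andP; split; apply/eqP; lia.
rewrite !mem_partitions_upto => /andP[/andP[px ?] ->] /and4P[hx -> /eqP ? /eqP ?].
rewrite is_partition_cons px eqxx hx ae ltnSn; split => //.
  have -> : all (fun z => z <= e1) x by apply: sub_all hx => z; lia.
  by rewrite /= !andbT; lia.
by apply/andP; split=> //; apply/andP; split; apply/eqP; lia.
Qed.

(** Raise the two upper ends one after the other, the second by symmetry, and eliminate the
    intermediate count. This is the product (1 - z q^e)(1 - q^e / z) expanded, with negative terms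
    moved across. *)
Lemma pair_count_rec N a e m s : 0 < a -> a <= e ->
  pair_count N a e.+1 m s + pair_count N a e.+1 m (s + e + e) =
  pair_count N a e m s + pair_count N a e.+1 (m - 1) (s + e)
  + pair_count N a e.+1 (m + 1) (s + e).
Proof.
move=> a0 ae.
have recr m' s' : pair_count N a e.+1 m' s' =
    pair_count2 N a e.+1 e m' s' + pair_count N a e.+1 (m' + 1) (s' + e).
  rewrite pair_count2_sym pair_count2_rec // -pair_count2_sym; congr (_ + _).
  by rewrite pair_count2_sym; congr pair_count2; lia.
have := recr m s; have := recr (m - 1)%R (s + e).
have := pair_count2_rec N e m s a0 ae.
have -> : (m - 1 + 1 = m)%R by lia.
by lia.
Qed.

(** A partition of size at most [N] has at most [N] parts; hence the sums over [t] can be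
    truncated. *)
Lemma pair_count_large N a e m s : (N%:Z < m)%R -> pair_count N a e m s = 0.
Proof.
move=> Nm; apply/eqP; rewrite -leqn0 leqNgt -has_count; apply/hasPn => -[x y].
rewrite mem_pairs_upto !mem_partitions_upto /= => /andP[/andP[px sx] _].
apply/negP => /and4P[_ _ /eqP]; rewrite /pair_rank /=.
by have := partition_size px; lia.
Qed.

Lemma pair_count_shift_large N a e m s : N < s -> pair_count N a e m s = 0.
Proof.
move=> Ns; apply/eqP; rewrite -leqn0 leqNgt -has_count; apply/hasPn => p _.
by apply/negP => /and4P[_ _ _ /eqP]; lia.
Qed.

Lemma parts_in_nil a s : parts_in a a s = (s == [::]).
Proof. by case: s => //= x s; have -> : (a <= x < a) = false by lia. Qed.

(** Besides starting the induction on [e], this yields the extra term at [m2 = 0]: a marker at the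
    top leaves an empty interval for the second pair. *)
Lemma pair_count_nil N a m s : pair_count N a a m s = (m == 0%R) && (s == N).
Proof.
rewrite /pair_count2.
rewrite (@eq_count _ _ (fun p => (p == ([::], [::])) && ((m == 0%R) && (s == N)))).
  case: (_ && _); last first.
    by rewrite (@eq_count _ _ pred0) ?count_pred0 // => p; rewrite andbF.
  rewrite (@eq_count _ _ (pred1 ([::],[::]))); last by move=> p; rewrite /= andbT.
  by rewrite count_uniq_mem ?pairs_upto_uniq // mem_pairs_upto mem_partitions_upto.
move=> [x y]; rewrite !parts_in_nil /pair_rank /weight xpair_eqE.
case: x => [|x0 x]; case: y => [|y0 y] /=; try by [].
by rewrite !addn0 GRing.subrr [0%R == m]eq_sym.
Qed.

(** * The one-marker identity *)

(** The right-hand side of the one-marker identity, cut at [B] terms. Here [z] is an integer because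
    the recurrence also visits [z - 1], which can be -1. *)
Definition tail_count N B a e (z : int) s :=
  \sum_(t < B) pair_count N a e (z + 1 + 2 * (t : nat)%:Z)%R s.

Lemma tail_count_rec N B a e z s : 0 < a -> a <= e ->
  tail_count N B a e.+1 z s + tail_count N B a e.+1 z (s + e + e) =
  tail_count N B a e z s + tail_count N B a e.+1 (z - 1) (s + e)
  + tail_count N B a e.+1 (z + 1) (s + e).
Proof.
move=> a0 ae; rewrite /tail_count -!big_split; apply: eq_bigr => t _ /=.
by rewrite pair_count_rec //; congr (_ + _ + _); congr pair_count2; lia.
Qed.

(** Both sums run in steps of 2 and differ by their first term; the surplus last term, at rank
    [z + 2 * B], vanishes by the bound. *)
Lemma tail_count_step N B a e z s : (N%:Z < z + 2 * B%:Z)%R ->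
  tail_count N B a e (z - 1) s = pair_count N a e z s + tail_count N B a e (z + 1) s.
Proof.
move=> NB; pose F t := pair_count N a e (z + 2 * t%:Z)%R s.
transitivity (\sum_(t < B.+1) F t).
  rewrite big_ord_recr /= [F B]pair_count_large // addn0.
  by apply: eq_bigr => t _; congr pair_count2; lia.
rewrite big_ord_recl {1}/F; congr (_ + _); first by congr pair_count2; rewrite /=; lia.
by apply: eq_bigr => t _; congr pair_count2; rewrite /= /bump /=; lia.
Qed.

(* [head 0 p.1] is the marker A; the condition is on the pair left when it is removed. *)
Definition marked a e m (p : seq nat * seq nat) :=
  let A := head 0 p.1 in
  [&& p.1 != [::], a <= A < e, parts_in a A.+1 (behead p.1), parts_in a A.+1 p.2
    & pair_rank (behead p.1, p.2) == m].

(** The left-hand side of the one-marker identity; [weight p] includes the marker, which accounts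
    for q^A. *)
Definition marked_count N a e m1 m2 s :=
  \sum_(p <- pairs_upto N | marked a e m1 p)
    pair_count N (head 0 p.1) e m2 (s + weight p).

Lemma marked_top N a e m s : 0 < a -> a <= e ->
  count (fun p => [&& marked a e.+1 m p, head 0 p.1 == e & s + weight p == N])
    (pairs_upto N) = pair_count N a e.+1 m (s + e).
Proof.
move=> a0 ae.
pose del (p : seq nat * seq nat) := (behead p.1, p.2).
pose ins (p : seq nat * seq nat) := (e :: p.1, p.2).
apply: (count_bij (f := del) (g := ins));
  rewrite ?pairs_upto_uniq // => -[x y]; rewrite !mem_pairs_upto /weight /pair_rank /=.
  rewrite !mem_partitions_upto.
  case: x => [|x0 x]; first by [].

  rewrite is_partition_cons => /andP[/andP[/and3P[_ _ px] ?] ->].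
  case/and3P=> /and5P[_ _ hx hy /eqP hr] /eqP /= xe /eqP ?.
  rewrite /pair_rank /= in hr.
  rewrite px -xe hx hy /ins /= xe; split=> //; first by rewrite andbT; lia.
  by apply/andP; split; apply/eqP; lia.
rewrite !mem_partitions_upto => /andP[/andP[px ?] ->] /and4P[hx hy /eqP ? /eqP ?].
rewrite is_partition_cons px; split => //.
  have -> : all (fun z => z <= e) x by apply: sub_all hx => z; lia.
  by rewrite /= !andbT; lia.
rewrite /marked /= hx hy eqxx ltnSn ae; apply/andP; split=> //; last by apply/eqP; lia.
by apply/eqP; rewrite /pair_rank /=; lia.
Qed.

(** Apply [pair_count_rec] to the second pair with the marker fixed. In the term with upper end [e],
    markers below [e] give [marked_count] again, while the marker [e] forces an empty second pair
    and is counted by [marked_top]. *)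
Lemma marked_count_rec N a e m1 m2 s : 0 < a -> a <= e ->
  marked_count N a e.+1 m1 m2 s + marked_count N a e.+1 m1 m2 (s + e + e) =
  marked_count N a e m1 m2 s + (m2 == 0%R) * pair_count N a e.+1 m1 (s + e)
  + marked_count N a e.+1 m1 (m2 - 1) (s + e)
  + marked_count N a e.+1 m1 (m2 + 1) (s + e).
Proof.
move=> a0 ae; rewrite /marked_count -big_split.
transitivity (\sum_(p <- pairs_upto N | marked a e.+1 m1 p)
  (pair_count N (head 0 p.1) e m2 (s + weight p)
   + pair_count N (head 0 p.1) e.+1 (m2 - 1) (s + e + weight p)
   + pair_count N (head 0 p.1) e.+1 (m2 + 1) (s + e + weight p))).
  apply: eq_bigr => p /and5P[_ hp _ _ _].
  have -> : s + e + e + weight p = s + weight p + e + e by lia.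
  have -> : s + e + weight p = s + weight p + e by lia.
  by rewrite /= pair_count_rec //; lia.
rewrite !big_split; congr (_ + _ + _).
rewrite (bigID (fun p => head 0 p.1 == e)) /= addnC; congr (_ + _).
  apply: eq_bigl => p; rewrite /marked.
  case: (p.1 != [::]); rewrite //=.
  case: (parts_in _ _ (behead _)); rewrite ?andbF //=.
  case: (parts_in _ _ _); rewrite ?andbF //=.
  by case: (_ == m1); rewrite ?andbF //= !andbT; lia.
rewrite -marked_top // -sum1_count big_distrr /=.
under eq_bigr => p /andP[_ /eqP he] do rewrite he pair_count_nil.
rewrite (bigID (fun p => s + weight p == N)) /= [X in _ + X]big1 ?addn0; last first.
  by move=> p /andP[_ /negbTE->]; rewrite andbF.
by apply: eq_big => [p|p /andP[_ ->]]; [rewrite andbA|rewrite andbT muln1].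
Qed.

Lemma pair_count_abs N a e m s : pair_count N a e `|m|%N s = pair_count N a e m s.
Proof.
by case: (boolP (0 <= m)%R) => m0; [|rewrite pair_count2_sym]; congr pair_count2; lia.
Qed.

(** Both sides vanish at [e = a]: no marker fits, and an empty pair cannot have rank at least 1. For
    larger [e] the two recurrences agree, and they refer only to a smaller upper end or a larger
    shift. *)
Lemma marked_count_tail N B a e m1 m2 s : N < 2 * B -> 0 < a -> a <= e ->
  marked_count N a e m1 m2 s = tail_count N B a e (`|m1| + `|m2|)%N s.
Proof.
move=> NB a0 /subnKC <-; move: (e - a) => {e} w.
elim: w m1 m2 s => [|w IHw] m1 m2 s.
  rewrite addn0 /marked_count /tail_count big1 => [|p /and5P[_ hp _ _ _]]; last by lia.
  rewrite big1 // => t _; rewrite pair_count_nil.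
  by case: eqP => // h; lia.
rewrite addnS; set e := a + w; have ae : a <= e by rewrite leq_addr.
(* Since [e > 0], the shifts [s + e] and [s + e + e] bring [N.+1 - s] down. *)
have [k] := ubnP (N.+1 - s); elim: k m2 s => // k IHk m2 s lk.
have [Ns|sN] := ltnP N s.
  rewrite /marked_count /tail_count !big1 // => *; rewrite pair_count_shift_large //.
  by apply: leq_trans Ns (leq_addr _ _).
have := marked_count_rec N m1 m2 s a0 ae.
rewrite !(IHk _ (s + e)) ?(IHk _ (s + e + e)) ?IHw -?/e; try lia.
have := tail_count_rec N B (`|m1| + `|m2|)%N s a0 ae.
have [->|m20] := eqVneq m2 0%R; last first.
  rewrite mul0n.
  have [m2p|m2n] := boolP (0 <= m2)%R.
    have -> : `|(m2 - 1)%R| = `|m2|.-1 by lia.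
    have -> : `|(m2 + 1)%R| = `|m2|.+1 by lia.
    have -> : ((`|m1| + `|m2|.-1)%N%:Z = (`|m1| + `|m2|)%N%:Z - 1)%R by lia.
    have -> : ((`|m1| + `|m2|.+1)%N%:Z = (`|m1| + `|m2|)%N%:Z + 1)%R by lia.
    by lia.
  have -> : `|(m2 + 1)%R| = `|m2|.-1 by lia.
  have -> : `|(m2 - 1)%R| = `|m2|.+1 by lia.
  have -> : ((`|m1| + `|m2|.-1)%N%:Z = (`|m1| + `|m2|)%N%:Z - 1)%R by lia.
  have -> : ((`|m1| + `|m2|.+1)%N%:Z = (`|m1| + `|m2|)%N%:Z + 1)%R by lia.
  by lia.
(* At [m2 = 0] both neighbours have absolute value 1, whereas the tail recurrence uses [z - 1] and
   [z + 1]. Trading the former for the latter releases exactly the extra term of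
   [marked_count_rec]. *)
rewrite tail_count_step; last by lia.
rewrite -(pair_count_abs N a e.+1 m1) !addn0 mul1n.
have -> : `|(0 - 1)%R| = 1%N by [].
have -> : `|(0 + 1)%R| = 1%N by [].
have -> : ((`|m1| + 1)%N%:Z = `|m1|%N%:Z + 1)%R by lia.
by rewrite !addnA => <- /addIn.
Qed.

(** * Chains of markers *)

Lemma count_allpairs (S T R : Type) (P : pred R) (f : S -> T -> R) s t :
  count P [seq f x y | x <- s, y <- t] = \sum_(x <- s) count (fun y => P (f x y)) t.
Proof.
elim: s => [|x s IH]; first by rewrite big_nil.
by rewrite big_cons /= count_cat IH count_map.
Qed.

Lemma sum_ffun_recl k B (F : nat -> nat) :
  \sum_(t : {ffun 'I_k.+1 -> 'I_B}) F (\sum_i (t i : nat)) =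
  \sum_(t : {ffun 'I_k -> 'I_B}) \sum_(u < B) F (u + \sum_i (t i : nat)).
Proof.
rewrite pair_big /=.
pose h (p : {ffun 'I_k -> 'I_B} * 'I_B) : {ffun 'I_k.+1 -> 'I_B} :=
  [ffun i => if unlift ord0 i is Some j then p.1 j else p.2].
rewrite (reindex h) /=; last first.
  exists (fun f : {ffun 'I_k.+1 -> 'I_B} => ([ffun j => f (lift ord0 j)], f ord0)).
    move=> [t u] _; rewrite ffunE unlift_none; congr (_, _).
    by apply/ffunP => j; rewrite !ffunE liftK.
  move=> f _; apply/ffunP => i; rewrite ffunE.
  by case: unliftP => [j|] -> //=; rewrite ffunE.
apply: eq_bigr => -[t u] _; rewrite big_ord_recl ffunE unlift_none /=; congr (F (_ + _)).
by apply: eq_bigr => j _; rewrite ffunE liftK.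
Qed.

(** A marked symbol read from its first pair on: each marker becomes the lower end for the next
    pair, and the weight already used is added to the shift. *)
Fixpoint chain N a D (ms : seq int) (ps : seq (seq nat * seq nat)) s : bool :=
  match ms, ps with
  | [:: m], [:: p] =>
      [&& parts_in a D.+1 p.1, parts_in a D.+1 p.2, pair_rank p == m & s + weight p == N]
  | m :: ms', p :: ps' =>
      marked a D.+1 m p && chain N (head 0 p.1) D ms' ps' (s + weight p)
  | _, _ => false
  end.

(** Once the first marker is fixed, the induction hypothesis turns the remaining pairs into single
    pairs of nonnegative rank; the one-marker identity then absorbs the first pair, adding
    [2 * u + 1] to the rank. *)
Lemma chain_count k B N a D ms s : size ms = k.+1 -> N < 2 * B -> 0 < a -> a <= D.+1 ->
  count (fun ps => chain N a D ms ps s) (lists_of k.+1 (pairs_upto N)) =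
  \sum_(t : {ffun 'I_k -> 'I_B})
    pair_count N a D.+1 (\sum_(x <- ms) `|x| + 2 * \sum_i (t i : nat) + k)%N s.
Proof.
move=> + NB; elim: k a ms s => [|k IHk] a ms s.
  case: ms => [|m []] // _ a0 aD; rewrite count_allpairs.
  rewrite [RHS](eq_bigr (fun _ => pair_count N a D.+1 m s)); last first.
    move=> t _; rewrite big_seq1 big_ord0 !addn0 pair_count_abs.
    by [].
  rewrite sum_nat_const card_ffun !card_ord expn0 mul1n /pair_count2 -sum1_count.
  by rewrite [RHS]big_mkcond; apply: eq_bigr => p _; rewrite /= addn0; case: ifP.
case: ms => [|m [|m' ms]] // [szm] a0 aD; set ms' := m' :: ms in szm *.
rewrite count_allpairs.
transitivity (\sum_(p <- pairs_upto N | marked a D.+1 m p)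
  count (fun ps => chain N (head 0 p.1) D ms' ps (s + weight p))
    (lists_of k.+1 (pairs_upto N))).
  rewrite [RHS]big_mkcond; apply: eq_bigr => p _.
  case: ifP => hp; first by apply: eq_count => l /=; rewrite hp.
  by rewrite (@eq_count _ _ pred0) ?count_pred0 // => l /=; rewrite hp.
under eq_bigr => p /and5P[_ /andP[ap pD] _ _ _].
  by rewrite (IHk _ ms' _ (congr1 S szm) (leq_trans a0 ap) (ltnW pD)); over.
rewrite exchange_big (@sum_ffun_recl _ _
  (fun S => pair_count N a D.+1 (\sum_(x <- m :: ms') `|x| + 2 * S + k.+1)%N s)).
apply: eq_bigr => t _; rewrite -/(marked_count N a D.+1 m _ s).
rewrite (marked_count_tail _ _ _ NB) //; apply: eq_bigr => u _.
by congr pair_count2; rewrite big_cons; lia.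
Qed.

Lemma mem_lists_of (T : eqType) k (xs : seq T) l :
  l \in lists_of k xs -> size l = k /\ {subset l <= xs}.
Proof.
elim: k l => [|k IH] l; first by rewrite inE => /eqP->.
case/allpairsP => -[x l'] /= [xs0 /IH[<- sl] ->]; split => // y.
by rewrite inE => /predU1P[->|/sl].
Qed.

(** The marker dominates all other parts, so bounding it by [D] bounds them all; the -1 in the rank
    is the removed marker. *)
Lemma markedE a D (m : int) p : is_partition p.1 ->
  marked a D.+1 m p =
  [&& all (fun x => a <= x) (p.1 ++ p.2),
      (p.1 != [::]) && all (fun x => x <= head 0 p.1) p.2,
      all (fun x => x <= D) (p.1 ++ p.2)
    & ((size p.1)%:Z - (size p.2)%:Z - 1)%R == m].
Proof.
have pin b c s : parts_in b c.+1 s = all (fun x => b <= x) s && all (fun x => x <= c) s.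
  by rewrite -all_predI; apply: eq_all => x.
case: p => [[|x u] v] /=; first by rewrite /marked /= !andbF.
rewrite is_partition_cons /marked /pair_rank /= => /and3P[_ xu _].
have -> : ((size u)%:Z - (size v)%:Z = (size u).+1%:Z - (size v)%:Z - 1)%R by lia.
rewrite !pin xu !all_cat andbT; case: (_ == m); rewrite ?andbF ?andbT //.
have [ax|] := leqP a x; rewrite //=.
rewrite ltnS; have [xD|] := leqP x D; rewrite ?andbF //=.
have -> : all (fun y => y <= D) u by apply: sub_all xu => y /leq_trans; apply.
case: (all (fun y => y <= x) v) / idP => [vx|_]; rewrite ?andbF ?andbT //=.
have -> : all (fun y => y <= D) v by apply: sub_all vx => y /leq_trans; apply.
by rewrite andbT.
Qed.

Lemma all_iotaS (P : pred nat) i k :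
  all P (iota i k.+1) = P i && all (fun j => P j.+1) (iota i k).
Proof.
rewrite [iota i _]/= [all _ _]/=; congr (_ && _).
by rewrite -[i.+1]addn1 addnC iotaDl all_map.
Qed.

Lemma chainE k N a D ms ps s :
  size ms = k.+1 -> size ps = k.+1 ->
  all (fun p => is_partition p.1 && is_partition p.2) ps ->
  chain N a D ms ps s =
  [&& all (fun x => a <= x) (dalpha (D, ps) 0 ++ dbeta (D, ps) 0),
      sumn [seq sumn p.1 + sumn p.2 | p <- ps] + s == N,
      all (fun j => (dalpha (D, ps) j != [::]) &&
                    all (fun x => x <= lpart (dalpha (D, ps) j)) (dbeta (D, ps) j)) (iota 0 k),
      all (fun j => all (fun x => lpart (dalpha (D, ps) j.-1) <= x)
                      (dalpha (D, ps) j ++ dbeta (D, ps) j)) (iota 1 k),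
      all (fun p => all (fun x => x <= D) (p.1 ++ p.2)) ps &
      all (fun j => drank k.+1 (D, ps) j == nth 0%R ms j) (iota 0 k.+1)].
Proof.
elim: k a ms ps s => [|k IHk] a ms ps s.
  case: ms ps => [|m []] // [|p []] // _ _ _.
  rewrite /= /dalpha /dbeta /drank /= /dalpha /dbeta /= !andbT addn0 addnC.
  rewrite /parts_in /weight /pair_rank !all_cat.
  have pin (t : seq nat) :
      all (fun x => a <= x < D.+1) t = all (fun x => a <= x) t && all (fun x => x <= D) t.
    by rewrite -all_predI; apply: eq_all.
  rewrite !pin.
  move: (all (fun x => x <= D) p.1) (all (fun x => x <= D) p.2) (_ == N) (_ == m).
  by move: (all (leq a) p.1) (all (leq a) p.2) => [] [] [] [] [] [].
case: ms ps => [|m [|m' ms]] // [|p [|p' ps]] // [szm] [szp] /andP[/andP[pp1 _] pps].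
set ms' := m' :: ms; set ps' := p' :: ps.
rewrite [LHS]/(marked a D.+1 m p && chain N (head 0 p.1) D ms' ps' (s + weight p)).
rewrite (IHk _ ms' ps' _ (congr1 S szm) (congr1 S szp) pps) markedE //.
rewrite [in RHS](all_iotaS _ 0 k) [in RHS](all_iotaS _ 1 k) [in RHS](all_iotaS _ 0 k.+1).
(* The truncated [j.-1] commutes with dropping the first pair only for [j > 0], hence the
   restriction to members of [iota 1 k]. *)
rewrite [X in _ = [&& _, _, _, _ && X, _ & _]](_ : _ = all (fun j =>
    all (fun x => lpart (dalpha (D, ps') j.-1) <= x)
      (dalpha (D, ps') j ++ dbeta (D, ps') j)) (iota 1 k)); last first.
  by apply: eq_in_all => -[|j]; rewrite mem_iota.
set X1 := all _ (dalpha (D, ps') 0 ++ _); set X3 := all _ (iota 0 k).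
set X4 := all _ (iota 1 k); set X5 := all _ ps'; set X6 := all _ (iota 0 k.+1).
set Y1 := all (fun x => a <= x) (p.1 ++ p.2); set Y2 := (p.1 != [::]) && _.
set Y3 := all _ (p.1 ++ p.2); set Y4 := _ == m.
rewrite [RHS](_ : _ = [&& Y1, sumn [seq sumn q.1 + sumn q.2 | q <- p :: ps'] + s == N,
  Y2 && X3, X1 && X4, Y3 && X5 & Y4 && X6]) //.
have -> : sumn [seq sumn q.1 + sumn q.2 | q <- p :: ps'] + s =
          sumn [seq sumn q.1 + sumn q.2 | q <- ps'] + (s + weight p).
  by rewrite /weight [map _ (p :: _)]/= [sumn (_ :: _)]/= -addnA addnC -addnA.
move: X1 X3 X4 X5 X6 Y1 Y2 Y3 Y4 (_ == N).
by do 10!case; rewrite //= ?andbF.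
Qed.

(** * Durfee squares and conjugation *)

Lemma geq_trans : transitive geq.
Proof. by move=> y x z; rewrite /geq /=; lia. Qed.

(** The entries above [i] form an initial segment. Both sides say that cell (i, j) lies in the
    diagram. *)
Lemma count_gt_sorted s i j : sorted geq s ->
  (j < count (fun x => i < x) s) = (i < nth 0 s j).
Proof.
elim: s j => [|x s IH] j; first by rewrite nth_nil.
rewrite /= path_sortedE; last exact: geq_trans.
move=> /andP[xs ss]; have [ix|xi] := ltnP i x; first by case: j => [|j] //=; rewrite -IH.
have s0 : count (fun y => i < y) s = 0.
  apply/eqP; rewrite -leqn0 leqNgt -has_count; apply/hasPn => y ys.
  by have := allP xs y ys; rewrite /geq /=; lia.
rewrite s0; case: j => [|j] /=; first by lia.
by rewrite -IH // s0.
Qed.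

Lemma count_lt_iota D x : \sum_(i <- iota 0 D) (i < x : nat) = minn D x.
Proof.
elim: D => [|D IH]; first by rewrite big_nil min0n.
by rewrite -addn1 iotaD big_cat big_seq1 IH /=; lia.
Qed.

(* The length D is prescribed: the result is padded with zeros up to D entries. *)
Definition conj_parts D s := [seq count (fun x => i < x) s | i <- iota 0 D].

Lemma size_conj_parts D s : size (conj_parts D s) = D.
Proof. by rewrite size_map size_iota. Qed.

Lemma nth_conj_parts D s i : i < D ->
  nth 0 (conj_parts D s) i = count (fun x => i < x) s.
Proof. by move=> iD; rewrite (nth_map 0) ?size_iota // nth_iota. Qed.

Lemma conj_parts_sorted D s : sorted geq (conj_parts D s).
Proof.
apply/(sortedP 0) => i; rewrite size_conj_parts => iD.
rewrite !nth_conj_parts //; last exact: ltnW.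
by apply: sub_count => x /ltnW.
Qed.

(** Transposing cells twice is the identity; prescribing [size s] entries restores trailing zeros as
    well. *)
Lemma conj_partsK D s : sorted geq s -> all (fun x => x <= D) s ->
  conj_parts (size s) (conj_parts D s) = s.
Proof.
move=> ss sD; apply: (@eq_from_nth _ 0); first exact: size_conj_parts.
move=> i; rewrite size_conj_parts => si; rewrite nth_conj_parts //.
suff h j : (j < count (fun x => i < x) (conj_parts D s)) = (j < nth 0 s i).
  apply/eqP; rewrite eqn_leq; apply/andP; split.
    by rewrite leqNgt h ltnn.
  by rewrite leqNgt -h ltnn.
rewrite count_gt_sorted ?conj_parts_sorted //; have [jD|Dj] := ltnP j D.
  by rewrite nth_conj_parts // count_gt_sorted.
rewrite nth_default ?size_conj_parts // ltn0; symmetry; apply: negbTE.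
by have /= := allP sD _ (mem_nth 0 si); lia.
Qed.

Lemma sumn_conj_parts D s : all (fun x => x <= D) s -> sumn (conj_parts D s) = sumn s.
Proof.
rewrite sumnE big_map; elim: s => [|x s IH] /=; first by rewrite big1.
by case/andP => xD /IH <-; rewrite big_split /= count_lt_iota (minn_idPr xD).
Qed.

Lemma head_conj_parts D s : parts_in 1 D.+1 s -> head 0 (conj_parts D s) = size s.
Proof.
case: D => [|D] hs; first by move: hs; rewrite parts_in_nil => /eqP->.
by apply/eqP; rewrite /= -all_count; apply: sub_all hs => x /andP[].
Qed.

Lemma sumn_map_addn D s : sumn (map (addn D) s) = size s * D + sumn s.
Proof. by elim: s => //= x s ->; lia. Qed.

(** The first two clauses make a square of side [D] fit; the last forbids side [D + 1], the default
    0 covering the end of [lam]. *)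
Definition has_durfee (lam : seq nat) D :=
  [&& D <= size lam, all (leq D) (take D lam) & nth 0 lam D <= D].

Lemma has_durfee_uniq lam D D' : has_durfee lam D -> has_durfee lam D' -> D = D'.
Proof.
wlog DD : D D' / D < D' => [h hD hD'|/and3P[_ _ hD] /and3P[sz hD' _]].
  by case: (ltngtP D D') => // lt; [|symmetry]; apply: h.
have := all_nthP 0 hD' D; rewrite size_take nth_take //.
by case: ifP => _ h; have := h ltac:(lia); lia.
Qed.

(** Take the least index [D] whose entry is at most [D]; by minimality the entry before it is at
    least [D]. *)
Lemma has_durfee_exists lam : sorted geq lam -> exists D, has_durfee lam D.
Proof.
move=> ss; have ex : exists i, nth 0 lam i <= i.
  by exists (size lam); rewrite nth_default.
case: (ex_minnP ex) => D hD minD; exists D; rewrite /has_durfee hD andbT.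
have Dsz : D <= size lam by apply: minD; rewrite nth_default.
rewrite Dsz; apply/(all_nthP 0) => i; rewrite size_takel // => iD; rewrite nth_take //.
have := sorted_leq_nth geq_trans leqnn 0 ss i D.-1; rewrite !inE /geq /=.
by have := minD D.-1; lia.
Qed.

Lemma mem_partitions n s : (s \in partitions n) = is_partition s && (sumn s == n).
Proof.
by rewrite mem_filter mem_partitions_upto; case: eqP => [->|]; rewrite ?leqnn ?andbT ?andbF.
Qed.

(** Cut off the square. The conjugate of the part to its right has [lpart lam - D] parts, the part
    below has [size lam - D], and the difference is the rank. *)
Lemma count_has_durfee n m D :
  count (fun lam => (prank lam == m) && has_durfee lam D) (partitions n) =
  pair_count n 1 D.+1 m (D * D).
Proof.
(* [mu lam] keeps zero rows to the right of the square; conjugating to exactly [head 0 (mu lam)]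
   entries makes every entry positive. *)
pose mu lam := map (subn^~ D) (take D lam).
pose f lam := (conj_parts (head 0 (mu lam)) (mu lam), drop D lam).
pose g (p : seq nat * seq nat) := map (addn D) (conj_parts D p.1) ++ p.2.
apply: (count_bij (f := f) (g := g)); rewrite ?pairs_upto_uniq //.
- exact/filter_uniq/partitions_upto_uniq.
- move=> lam; rewrite mem_partitions => /andP[/andP[sl pl] /eqP sn].
  case/andP=> /eqP rk /and3P[Dsz tD hD].
  have szmu : size (mu lam) = D by rewrite size_map size_takel.
  have muD : map (addn D) (mu lam) = take D lam.
    rewrite -map_comp -[RHS]map_id; apply/eq_in_map => x xt /=.
    by rewrite subnKC // (allP tD).
  have smu : sorted geq (mu lam).
    have := take_sorted D sl; rewrite -muD sorted_map.
    by apply: sub_sorted => x y; rewrite /geq /=; lia.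
  have mub : all (fun x => x <= head 0 (mu lam)) (mu lam).
    case: (mu lam) smu => //= x s; rewrite path_sortedE; last exact: geq_trans.
    by case/andP => xs _; rewrite leqnn.
  have sdrop : sumn lam = D * D + sumn (mu lam) + sumn (drop D lam).
    by rewrite -{1}(cat_take_drop D lam) sumn_cat -muD sumn_map_addn szmu.
  have hin : parts_in 1 D.+1 (f lam).1.
    apply/allP => y /mapP[i]; rewrite mem_iota /= => ih ->.
    have := count_size (fun x => i < x) (mu lam); rewrite szmu.
    have := count_gt_sorted i 0 smu; rewrite nth0 ih; lia.
  have hin2 : parts_in 1 D.+1 (f lam).2.
    apply/(all_nthP 0) => i; rewrite size_drop nth_drop => iD.
    rewrite (allP pl) ?mem_nth //=; last lia.
    have := sorted_leq_nth geq_trans leqnn 0 sl D (D + i); rewrite !inE /geq /=.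
    lia.
  have hsum := sumn_conj_parts mub.
  split.
  + rewrite mem_pairs_upto !mem_partitions_upto /= hsum -!andbA.
    have pos t : parts_in 1 D.+1 t -> all (fun x => 0 < x) t.
      by apply: sub_all => x /andP[].
    rewrite /is_partition conj_parts_sorted (pos _ hin) drop_sorted // (pos _ hin2) /=.
    by rewrite -sn sdrop leq_addl andbT -addnA addnCA leq_addr.
  + rewrite hin hin2 /= /weight hsum -rk /pair_rank /prank /= size_conj_parts size_drop.
    apply/andP; split; last by rewrite -sn sdrop addnA.
    case: (lam) Dsz hD tD @mu {f g szmu muD smu mub sdrop hin hin2 hsum} => [|x l] /=.
      by move=> D0 _ _; rewrite /= ; apply/eqP; lia.
    (* With [D = 0] the first part would be 0, against positivity; otherwise the first row meets the
       square. *)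
    move=> Dsz; case: (D) Dsz => [|E] /=; first by move=> _; have := pl; lia.
    by rewrite /lpart /= => ? _ /andP[? _]; apply/eqP; lia.
  + have conjK : conj_parts D (conj_parts (head 0 (mu lam)) (mu lam)) = mu lam.
      by rewrite -{1}szmu conj_partsK.
    by rewrite /f /g /= conjK muD cat_take_drop.
- move=> [x y]; rewrite mem_pairs_upto !mem_partitions_upto /=.
  case/andP => /andP[/andP[sx px] nx] /andP[/andP[sy py] ny].
  case/and4P=> hx hy /eqP rk /eqP; rewrite /weight /= => hn.
  have xD : all (fun z => z <= D) x by apply: sub_all hx => z /andP[].
  have szg : size (map (addn D) (conj_parts D x)) = D by rewrite size_map size_conj_parts.
  have tg : take D (g (x, y)) = map (addn D) (conj_parts D x) by rewrite take_size_cat.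
  have dg : drop D (g (x, y)) = y by rewrite drop_size_cat.
  have mug : mu (g (x, y)) = conj_parts D x.
    by rewrite /mu tg -map_comp -[RHS]map_id; apply/eq_map => z /=; rewrite addKn.
  split.
  + rewrite mem_partitions /g /is_partition sumn_cat sumn_map_addn size_conj_parts.
    rewrite sumn_conj_parts //; apply/andP; split; last by rewrite -hn addnA.
    apply/andP; split.
      rewrite sorted_pairwise; last exact: geq_trans.
      rewrite pairwise_cat -!(sorted_pairwise geq_trans) sy andbT; apply/andP; split.
        apply/allrelP => u v /mapP[w _ ->] vy; have /= := allP hy v vy; rewrite /geq /=; lia.
      rewrite sorted_map; apply: sub_sorted (conj_parts_sorted D x) => u v.
      by rewrite /geq /=; lia.
    rewrite all_cat py andbT; apply/allP => u /mapP[w] /mapP[i].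
    by rewrite mem_iota => ? _ ->; lia.
  + apply/andP; split; last first.
      rewrite /has_durfee tg /g size_cat szg leq_addr andTb nth_cat szg ltnn subnn nth0.
      apply/andP; split; first by apply/allP => u /mapP[w _ ->]; rewrite leq_addr.
      by case: (y) hy => //= b l /andP[/andP[]].
    rewrite -rk /prank /pair_rank /g size_cat szg /= -(head_conj_parts hx).
    rewrite /lpart; case: (D) hx hy => [|E].
      by rewrite !parts_in_nil => _ /eqP->.
    by move=> _ _; apply/eqP; rewrite /=; lia.
  + by rewrite /f dg mug head_conj_parts // conj_partsK.
Qed.

(** Each partition of [n] has exactly one Durfee side, which is at most its length and so at most
    [n]. *)
Lemma Nrank_durfee m n :
  Nrank m n = \sum_(D <- iota 0 n.+1) pair_count n 1 D.+1 m (D * D).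
Proof.
under eq_bigr => D _ do rewrite -count_has_durfee -sum1_count big_mkcond /=.
rewrite exchange_big /Nrank -sum1_count big_mkcond /=.
apply: eq_big_seq => lam; rewrite mem_partitions => /andP[pl /eqP sn].
case: (prank lam == m); last by rewrite big1.
have [D hD] := has_durfee_exists (proj1 (andP pl)).
rewrite -big_mkcond sum1_count (@eq_count _ _ (pred1 D)) => [|D'] /=.
  rewrite count_uniq_mem ?iota_uniq // mem_iota.
  have := partition_size pl; case/and3P: hD => + _ _; lia.
by apply/idP/eqP => [h|->] //; apply: has_durfee_uniq h hD.
Qed.

(** * Marked Durfee symbols as chains, and conclusion *)

Lemma Dk_chain k n ms : size ms = k.+1 ->
  Dk k.+1 ms n = \sum_(D <- iota 0 n.+1)
    count (fun ps => chain n 1 D ms ps (D * D)) (lists_of k.+1 (pairs_upto n)).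
Proof.
move=> szm; rewrite /Dk /durfee_cands count_allpairs; apply: eq_bigr => D _.
apply: eq_in_count => ps /mem_lists_of[szp sps].
have pps : all (fun p => is_partition p.1 && is_partition p.2) ps.
  apply/allP => p /sps; rewrite mem_pairs_upto !mem_partitions_upto.
  by case/andP => /andP[-> _] /andP[-> _].
have pos : all (fun x => 1 <= x) (dalpha (D, ps) 0 ++ dbeta (D, ps) 0).
  case: ps szp pps {sps} => // p ps _ /andP[/andP[/andP[_ h1] /andP[_ h2]] _].
  by rewrite all_cat; apply/andP.
rewrite (chainE _ _ _ _ szm szp) // pos andTb /is_durfee [in LHS]/= -/(iota 0 k.+1).
rewrite szp eqxx pps !andTb -!andbA.
by [].
Qed.

(* The infinite sum over t_1..t_{k-1} >= 0 (nonnegative terms) is expressed as the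
   eventual value of its partial sums over boxes [0, B']^(k-1). *)
Theorem mainTheorem9 (k n : nat) (m : k.-tuple int) :
  2 <= k ->
  exists B : nat, forall B' : nat, B <= B' ->
    Dk k m n =
    \sum_(t : {ffun 'I_k.-1 -> 'I_B'.+1})
       Nrank ((\sum_(x <- m) absz x + 2 * \sum_(i < k.-1) (t i : nat) + k.-1)%N)%:Z n.
Proof.
(* Any box containing [0, n] suffices: [n < 2 * B.+1] is the truncation bound of [chain_count]. *)
case: k m => // k m _; exists n => B nB.
rewrite Dk_chain ?size_tuple //.
have nB2 : n < 2 * B.+1 by lia.
under eq_bigr => D _ do rewrite (chain_count _ (size_tuple m) nB2) //.
by rewrite exchange_big; apply: eq_bigr => t _; rewrite Nrank_durfee.
Qed.
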